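(* Let $D$ be a division ring with uncountable center $F$ and let $G$ be a non-central almost subnormal subgroup of $D^*$ (non-central means $G\not\subseteq F$). If $G\setminus F$ contains an element that is algebraic over $F$, then $G$ contains a non-cyclic free subgroup.
   Context: $D^*$ is the multiplicative group of non-zero elements of $D$. A subgroup $H$ of a group $G$ is almost subnormal in $G$ if there are subgroups $H=H_r\le H_{r-1}\le\cdots\le H_1=G$ such that for each $1<i\le r$, $H_i$ is normal in $H_{i-1}$ or $H_i$ has finite index in $H_{i-1}$. *)

(* Defs.v *)
From HB Require Import structures.
From mathcomp Require Import all_boot all_algebra.
From mathcomp Require Import boolp classical_sets functions cardinality.

Set Implicit Arguments.
Unset Strict Implicit.
Unset Printing Implicit Defensive.

Import GRing.Theory.

Local Open Scope classical_set_scope.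
Local Open Scope group_scope.

Section Groups.
Variable T : groupType.
Implicit Types (G H K N X : set T) (w : seq (T * bool)).

Definition subgroup H : Prop :=
  [/\ H 1, (forall x y, H x -> H y -> H (x * y)) & (forall x, H x -> H x^-1)].

Definition normal_in N K : Prop :=
  N `<=` K /\ (forall x y, K x -> N y -> N (y ^ x)).

Definition lcoset_of N (x : T) : set T := [set x * y | y in N].

Definition finite_index_in N K : Prop :=
  N `<=` K /\ finite_set [set lcoset_of N x | x in K].

(* The chain is indexed from 0: C i stands for H_(i+1) and n for r - 1. *)
Definition almost_subnormal H G : Prop :=
  exists (n : nat) (C : nat -> set T),
    [/\ C 0%N = G, C n = H,
        (forall i, (i <= n)%N -> subgroup (C i)),
        (forall i, (i < n)%N -> C i.+1 `<=` C i) &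
        (forall i, (i < n)%N ->
           normal_in (C i.+1) (C i) \/ finite_index_in (C i.+1) (C i))].

Definition generated X : set T := smallest subgroup X.

Definition cyclic_subgroup H : Prop := exists x, H = generated [set x].

(* The letter (x, b) stands for x if b is false and for x^-1 if b is true. *)
Definition letter_val (l : T * bool) : T := if l.2 then l.1^-1 else l.1.

Definition word_val w : T := \prod_(l <- w) letter_val l.

Definition reduced_word w : bool :=
  sorted (fun l m : T * bool => ~~ ((l.1 == m.1) && (l.2 != m.2))) w.

Definition free_basis X H : Prop :=
  H = generated X /\
  (forall w, (forall l, l \in w -> X l.1) -> reduced_word w -> w <> [::] ->
     word_val w <> 1).

Definition free_subgroup H : Prop := exists X, free_basis X H.

End Groups.

(* The group of units of a ring; in mathcomp, {unit R} exists only for finite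
   rings.  When R is a division ring this is the group R^* of all its nonzero
   elements. *)
Section UnitGroup.
Local Open Scope ring_scope.
Variable R : unitRingType.

Inductive unit_group : Type := UnitGroup (x : R) of x \is a GRing.unit.

Definition unit_val (u : unit_group) : R := let: UnitGroup x _ := u in x.

HB.instance Definition _ := [isSub for unit_val].
HB.instance Definition _ := [Choice of unit_group by <:].

Lemma unit_group_invP (u : unit_group) : (val u)^-1 \is a GRing.unit.
Proof. by rewrite unitrV (valP u). Qed.

Lemma unit_group_mulP (u v : unit_group) : val u * val v \is a GRing.unit.
Proof. by rewrite (unitrMr _ (valP u)) (valP v). Qed.

Definition unit_group_one : unit_group := UnitGroup (@unitr1 R).
Definition unit_group_inv u : unit_group := UnitGroup (unit_group_invP u).
Definition unit_group_mul u v : unit_group := UnitGroup (unit_group_mulP u v).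

Lemma unit_group_mulA : associative unit_group_mul.
Proof. by move=> u v w; apply/val_inj/mulrA. Qed.
Lemma unit_group_mul1 : left_id unit_group_one unit_group_mul.
Proof. by move=> u; apply/val_inj/mul1r. Qed.
Lemma unit_group_mulr1 : right_id unit_group_one unit_group_mul.
Proof. by move=> u; apply/val_inj/mulr1. Qed.
Lemma unit_group_mulV : left_inverse unit_group_one unit_group_inv unit_group_mul.
Proof. by move=> u; apply/val_inj/(mulVr (valP u)). Qed.
Lemma unit_group_mulrV :
  right_inverse unit_group_one unit_group_inv unit_group_mul.
Proof. by move=> u; apply/val_inj/(mulrV (valP u)). Qed.

HB.instance Definition _ := isGroup.Build unit_group
  unit_group_mulA unit_group_mul1 unit_group_mulr1
  unit_group_mulV unit_group_mulrV.

End UnitGroup.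

Section DivisionRings.
Local Open Scope ring_scope.
Variable D : unitRingType.

Definition division_ring : Prop := forall x : D, x != 0 -> x \is a GRing.unit.

Definition ring_center : set D := [set x | forall y : D, GRing.comm x y].

(* The coefficients of p commute with a, so the side on which they multiply
   the powers of a in p.[a] is irrelevant. *)
Definition algebraic_over_center (a : D) : Prop :=
  exists p : {poly D}, [/\ p != 0, (forall i, ring_center p`_i) & root p a].

End DivisionRings.

Arguments division_ring D : clear implicits.
Arguments ring_center D : clear implicits.

(* Main.v *)
(* Let a in G be algebraic over F and not in F, let C be its centralizer and
   f = E ('X - a) its minimal polynomial.  Letting the variable act on D by
   right multiplication by a makes D a module over D[X]; there f acts as 0,
   while E acts as a nonzero C-bilinear map e : D -> C.  For central t, the
   inverse of t - a is E(t) / f(t), so words in elements t - a and constants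
   are P(t) / f(t)^N, with a "leading coefficient" given by the action of P.
   For y(t) = k (t - a)^-1 g (t - a) the element y m y^-1 and its inverse both
   have leading coefficients of rank one, x |-> v e(u x).  The product of two
   such coefficients, x |-> v e(u v') e(u' x), is nonzero as soon as
   e(u v') <> 0, which also keeps its rank equal to one.  Commutators with a
   (at the normal steps of the chain) and powers (at the steps of finite index)
   push these elements down into G and only change u and v by powers of a.  For
   generic k1, k2, g two such families have all required pairings nonzero, so
   every nonempty reduced word has a pole and differs from 1 for all but
   finitely many t.  There are countably many words and uncountably many t. *)
Require Import Defs.
From mathcomp Require Import all_boot all_algebra.
From mathcomp Require Import boolp classical_sets functions cardinality.

Set Implicit Arguments.
Unset Strict Implicit.
Unset Printing Implicit Defensive.

Import GRing.Theory.

Local Open Scope classical_set_scope.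
Local Open Scope ring_scope.

(** * Groups *)

Section Groups.
Variable T : groupType.
Local Open Scope group_scope.
Implicit Types (N K X : set T) (x y z : T).

Lemma subgroup_generated X : subgroup (generated X).
Proof.
split=> [M [[M1 _ _] _]|x y Xx Xy M XM|x Xx M XM]; first exact: M1.
  by case: (XM) => [[_ mulM _] _]; apply: mulM; [apply: Xx|apply: Xy].
by case: (XM) => [[_ _ invM] _]; apply: invM; apply: Xx.
Qed.

Lemma subgroup_expg K x n : subgroup K -> K x -> K (x ^+ n).
Proof.
by case=> K1 KM _ Kx; elim: n => [|n IH]; rewrite ?expg0 // expgS; apply: KM.
Qed.

(** Pigeonhole: two of the cosets of [x ^+ i] with i at most [size s] coincide, so some exponent
    between 1 and [size s] works for [x]. The factorial is a common multiple of all these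
    exponents. *)
Lemma finite_index_expg N K : subgroup N -> subgroup K -> finite_index_in N K ->
  exists m, forall x, K x -> N (x ^+ m.+1).
Proof.
move=> sN sK [_ /finite_seqP[s defs]]; exists ((size s)`!).-1 => x Kx.
rewrite prednK ?fact_gt0 //.
pose h i := lcoset_of N (x ^+ i).
have hs : {subset map h (iota 0 (size s).+1) <= s}.
  move=> _ /mapP[i _ ->]; have : [set` s] (h i).
    by rewrite -defs; exists (x ^+ i) => //; apply: subgroup_expg.
  by [].
have /(uniqPn (h 0%N)) [i [j [ij]]] : ~~ uniq (map h (iota 0 (size s).+1)).
  by apply/negP => /uniq_leq_size/(_ hs); rewrite size_map size_iota ltnn.
rewrite size_map size_iota => js; have is_ := ltn_trans ij js.
rewrite !(nth_map 0%N) ?size_iota // !nth_iota // !add0n => hij.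
have [N1 _ _] := sN.
have : h j (x ^+ j) by exists 1; rewrite ?mulg1.
rewrite -hij => -[y Ny /(canRL (mulKg _)) defy].
have Nx : N (x ^+ (j - i)).
  by move: Ny; rewrite defy -{1}(subnKC (ltnW ij)) expgnDr mulKg.
have /dvdnP[q ->] : (j - i %| (size s)`!)%N.
  by apply: dvdn_fact; rewrite subn_gt0 ij (leq_trans (leq_subr _ _)).
by rewrite mulnC expgnA; apply: subgroup_expg.
Qed.

Lemma cyclic_commute K : cyclic_subgroup K -> {in K &, forall x y, commute x y}.
Proof.
case=> z ->; have cent y : subgroup [set x | commute x y].
  split=> [|u v /= uy vy|u /= uy]; first exact/commute_sym/commute1.
    exact/commute_sym/commuteM/commute_sym.
  by apply/commute_sym/commuteV/commute_sym.
have Kz y : generated [set z] y -> commute z y.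
  by move=> Ky; apply/commute_sym/(Ky [set y | commute y z]); split=> // _ ->.
move=> x y /set_mem Kx /set_mem Ky; apply: (Kx [set x | commute x y]).
by split=> // _ ->; apply: Kz.
Qed.

(** The letters are indices rather than group elements, so that one countable set of words serves
    for every value of t. *)
Definition reduced_bool (w : seq (bool * bool)) : bool :=
  sorted (fun l m => ~~ ((l.1 == m.1) && (l.2 != m.2))) w.

(** A two-letter reduced word keeps the generators distinct, and the commutator word excludes
    cyclicity. *)
Lemma free_pair (x : bool -> T) :
    (forall w, reduced_bool w -> w <> [::] ->
       \prod_(l <- w) letter_val (x l.1, l.2) <> 1) ->
  free_subgroup (generated (range x)) /\ ~ cyclic_subgroup (generated (range x)).
Proof.
move=> x_free; have x_neq : x true != x false.
  apply/eqP => e; apply: (x_free [:: (true, false); (false, true)]) => //.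
  by rewrite !big_cons big_nil /letter_val /= mulg1 e mulgV.
split.
  exists (range x); split=> // w wX red_w w0.
  pose u := [seq (l.1 == x true, l.2) | l <- w].
  have def_w : w = [seq (x l.1, l.2) | l <- u].
    rewrite -map_comp -[LHS]map_id; apply/eq_in_map => -[y b] /wX /= [c _ <-] /=.
    by case: c; rewrite ?eqxx // eq_sym (negPf x_neq).
  rewrite /word_val def_w big_map; apply: x_free => [|u0]; last first.
    by apply: w0; rewrite def_w u0.
  rewrite /reduced_bool; move: red_w; rewrite /reduced_word.
  rewrite [X in sorted _ X]def_w sorted_map.
  apply: sub_sorted => -[c b] [c' b'] /=; rewrite /relpre /=.
  by apply: contra => /andP[/eqP-> ->]; rewrite eqxx.
move/cyclic_commute => comm.
have Xx b : x b \in generated (range x).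
  by apply: mem_set; apply: sub_gen_smallest; exists b.
apply: (x_free [:: (true, false); (false, false); (true, true); (false, true)]) => //.
rewrite !big_cons big_nil /letter_val /= mulg1 mulgA (comm _ _ (Xx true) (Xx false)).
by rewrite -mulgA (mulgA (x true)) mulgV mul1g mulgV.
Qed.

End Groups.

Section DivisionRing.
Variable D : unitRingType.
Hypothesis hD : division_ring D.
Implicit Types (x y z c s t : D) (P Q R : {poly D}).

(** * Computations in a division ring *)

Lemma div_mulVr x : x != 0 -> x^-1 * x = 1.
Proof. by move=> x0; rewrite mulVr ?hD. Qed.

Lemma div_mulrV x : x != 0 -> x * x^-1 = 1.
Proof. by move=> x0; rewrite mulrV ?hD. Qed.

Lemma div_mul_eq0 x y : (x * y == 0) = (x == 0) || (y == 0).
Proof.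
have [->|x0] := eqVneq x 0; first by rewrite mul0r eqxx.
have [->|y0] := eqVneq y 0; first by rewrite mulr0 eqxx.
apply: contraNF y0 => /eqP xy0.
by rewrite -[y]mul1r -(div_mulVr x0) -mulrA xy0 mulr0.
Qed.

Lemma div_mul_neq0 x y : x != 0 -> y != 0 -> x * y != 0.
Proof. by move=> x0 y0; rewrite div_mul_eq0 negb_or x0. Qed.

Lemma div_expr_neq0 x n : x != 0 -> x ^+ n != 0.
Proof.
by move=> x0; elim: n => [|n IH]; rewrite ?expr0 ?oner_eq0 ?exprS ?div_mul_neq0.
Qed.

Lemma div_inv_neq0 x : x != 0 -> x^-1 != 0.
Proof. by move=> x0; rewrite invr_eq0. Qed.

Lemma ring_center0 : ring_center D 0.
Proof. by move=> y; rewrite /GRing.comm mul0r mulr0. Qed.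

Lemma hornerM_center P Q t : ring_center D t -> (P * Q).[t] = P.[t] * Q.[t].
Proof. by move=> Ft; apply/hornerM_comm/Ft. Qed.

(* Evaluation on the right is not multiplicative, but it only depends on the
   right factor modulo the left ideal generated by 'X - c. *)
Lemma hornerM_rem P Q c : (P * Q).[c] = (P * (Q.[c])%:P).[c].
Proof.
have /factor_theorem[S defS] : root (Q - (Q.[c])%:P) c.
  by rewrite /root hornerD hornerN hornerC subrr.
rewrite -[Q in LHS](subrK (Q.[c])%:P) defS mulrDr hornerD mulrA.
rewrite (_ : (_ * ('X - _)).[c] = 0) ?add0r //.
by apply/rootP/factor_theorem; exists (P * S).
Qed.

(** * Rational functions of a central variable *)

Definition cofinitely (A : D -> Prop) :=
  finite_set [set t | ring_center D t /\ ~ A t].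

Lemma cofinitely_sub (A B : D -> Prop) :
  (forall t, ring_center D t -> A t -> B t) -> cofinitely A -> cofinitely B.
Proof. by move=> AB; apply: sub_finite_set => t [Ft nB]; split=> // /(AB _ Ft). Qed.

Lemma cofinitely_and (A B : D -> Prop) :
  cofinitely A -> cofinitely B -> cofinitely (fun t => A t /\ B t).
Proof.
move=> fA fB; apply: (@sub_finite_set _ _ ([set t | ring_center D t /\ ~ A t] `|`
   [set t | ring_center D t /\ ~ B t])); last by rewrite finite_setU.
move=> t [Ft /= nAB]; have [At|nAt] := pselect (A t); last by left.
by right; split=> // Bt; apply: nAB.
Qed.

Lemma cofinitely_seq (I : eqType) (r : seq I) (A : I -> D -> Prop) :
    (forall i, i \in r -> cofinitely (A i)) ->
  cofinitely (fun t => forall i, i \in r -> A i t).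
Proof.
elim: r => [_|i r IH Ar].
  by apply: (@sub_finite_set _ _ set0) => // t [_ []].
apply: cofinitely_sub (cofinitely_and (Ar i (mem_head _ _)) (IH _)).
  by move=> t _ [Ai Ar'] j; rewrite inE => /predU1P[->|/Ar'].
by move=> j rj; apply: Ar; rewrite inE rj orbT.
Qed.

Lemma cofinitely_subsingleton (A : D -> Prop) :
    (forall s t, ring_center D s -> ring_center D t -> ~ A s -> ~ A t -> s = t) ->
  cofinitely A.
Proof.
move=> uA; have [[s [Fs nAs]]|n] := pselect (exists s, ring_center D s /\ ~ A s).
  by apply: (@sub_finite_set _ _ [set s]) => // t [Ft nAt]; apply: uA.
by apply: (@sub_finite_set _ _ set0) => // t Bt; case: n; exists t.
Qed.

Lemma cofinitely_neq c : cofinitely (fun t => t != c).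
Proof.
by apply: cofinitely_subsingleton => s t _ _ /negP/negPn/eqP-> /negP/negPn/eqP->.
Qed.

(** Evaluation at central points is multiplicative, so a central root s splits off ['X - s%:P] and
    the degree drops. *)
Lemma cofinitely_horner P : P != 0 -> cofinitely (fun t => P.[t] != 0).
Proof.
elim/ltn_ind: (size P) {-2}P (erefl (size P)) => n IH {}P sP P0.
have [[s [Fs Ps]]|nr] := pselect (exists s, ring_center D s /\ root P s); last first.
  apply: (@sub_finite_set _ _ set0) => // t [Ft /negP/negPn rt].
  by case: nr; exists t.
have /factor_theorem[Q defP] := Ps.
have Q0 : Q != 0 by apply: contraNneq P0 => Q0; rewrite defP Q0 mul0r.
have sQ : (size Q < n)%N.
  rewrite -sP defP size_Mmonic ?monicXsubC // size_XsubC addn2 /=.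
  exact: ltnSn.
apply: cofinitely_sub (cofinitely_and (cofinitely_neq s) (IH _ sQ _ erefl Q0)).
move=> t Ft [ts Qt]; rewrite defP hornerM_center // hornerXsubC.
by rewrite div_mul_neq0 // subr_eq0.
Qed.

Lemma cofinitely_affine x y :
  x != 0 \/ y != 0 -> cofinitely (fun t => x + t * y != 0).
Proof.
move=> xy; have: x%:P + 'X * y%:P != 0.
  apply/eqP => /polyP xy0; case: xy => [/eqP|/eqP]; apply.
    by have := xy0 0%N; rewrite coefD coefC coefXM /= addr0 coef0.
  by have := xy0 1%N; rewrite coefD coefC coefXM coefC /= add0r coef0.
move/cofinitely_horner; apply: cofinitely_sub => t Ft.
by rewrite hornerD hornerM_center // !hornerC hornerX.
Qed.

(* Clearing the denominators of a combination of resolvents from the left. *)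
Lemma resolvent_denominator (r : seq (D * D)) c s0 :
    ring_center D s0 -> s0 != c ->
  exists P Q, Q.[s0] != 0 /\ forall s, ring_center D s -> s != c ->
    Q.[s] * (\sum_(p <- r) p.1 * (s - c)^-1 * p.2) = P.[s].
Proof.
move=> Fs0 s0c; elim: r => [|[x y] r [P [Q [Q0 PQ]]]].
  exists 0, 1; split=> [|s _ _]; first by rewrite hornerC oner_eq0.
  by rewrite big_nil mulr0 horner0.
pose z := (Q * x%:P).[c].
(* For nonzero [z], [d] is the conjugate of [c] that makes [('X - d%:P) * (Q * x%:P)] vanish at [c].
   It differs from [s0] because a central element is conjugate only to itself. *)
have [d [dz ds0]] : exists d, d * z = z * c /\ s0 != d.
  have [z0|z0] := eqVneq z 0; first by exists c; rewrite z0 mulr0 mul0r.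
  exists (z * c * z^-1); rewrite -!mulrA div_mulVr // mulr1; split=> //.
  apply: contraNneq s0c => e; rewrite -[s0]mulr1 -(div_mulVr z0) mulrA.
  by rewrite (Fs0 z^-1) e !mulrA div_mulVr // mul1r -mulrA div_mulVr // mulr1.
have /factor_theorem[S defS] : root (('X - d%:P) * (Q * x%:P)) c.
  rewrite /root hornerM_rem -/z mulrBl -commr_polyX -polyCM hornerD hornerN.
  by rewrite hornerC hornerMX hornerC dz subrr.
exists (S * y%:P + ('X - d%:P) * P), (('X - d%:P) * Q); split.
  by rewrite hornerM_center // hornerXsubC div_mul_neq0 // subr_eq0.
move=> s Fs sc; rewrite big_cons /= mulrDr hornerD; congr (_ + _); last first.
  by rewrite !hornerM_center // -mulrA PQ.
have sc0 : s - c != 0 by rewrite subr_eq0.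
have := congr1 (fun R => R.[s]) defS.
rewrite !hornerM_center // !hornerXsubC !hornerC => e.
by rewrite !mulrA -[_ * Q.[s] * x]mulrA e -[_ * _ * _^-1]mulrA div_mulrV // mulr1.
Qed.

(** The numerator is nonzero at [s0], hence a nonzero polynomial with finitely many central
    roots. *)
Lemma cofinitely_resolvent (r : seq (D * D)) c s0 :
    ring_center D s0 -> s0 != c ->
    \sum_(p <- r) p.1 * (s0 - c)^-1 * p.2 != 0 ->
  cofinitely (fun s => \sum_(p <- r) p.1 * (s - c)^-1 * p.2 != 0).
Proof.
move=> Fs0 s0c r0; have [P [Q [Q0 PQ]]] := resolvent_denominator r Fs0 s0c.
have P0 : P != 0.
  apply: contraNneq (div_mul_neq0 Q0 r0) => P0.
  by rewrite PQ // P0 horner0.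
apply: cofinitely_sub (cofinitely_and (cofinitely_neq c) (cofinitely_horner P0)).
move=> s Fs [sc Ps]; apply: contraNneq Ps => e.
by rewrite -PQ // e mulr0.
Qed.

(** * The residue at an algebraic element *)

Section Residue.
Variable a : D.

(* With [a] acting by right multiplication, D is a module over {poly D};
   this is the map induced by the specialization of the central variable to a
   root of the minimal polynomial of [a]. *)
Definition act P x : D := (P * x%:P).[a].

Lemma actD P x y : act P (x + y) = act P x + act P y.
Proof. by rewrite /act polyCD mulrDr hornerD. Qed.

Lemma actB P x y : act P (x - y) = act P x - act P y.
Proof. by rewrite /act polyCB mulrBr hornerD hornerN. Qed.

Lemma act_center P t x : ring_center D t -> act P (t * x) = t * act P x.
Proof.
move=> Ft; rewrite /act; have -> : P * (t * x)%:P = t%:P * (P * x%:P).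
  rewrite polyCM !mulrA; congr (_ * _).
  by apply/polyP => i; rewrite coefCM coefMC Ft.
by rewrite mul_polyC hornerZ.
Qed.

Lemma actM P Q x : act (P * Q) x = act P (act Q x).
Proof. by rewrite /act -mulrA hornerM_rem. Qed.

Lemma actC c x : act c%:P x = c * x.
Proof. by rewrite /act -polyCM hornerC. Qed.

Lemma actXsub c x : act ('X - c%:P) x = x * a - c * x.
Proof.
by rewrite /act mulrBl -commr_polyX -polyCM hornerD hornerN hornerMX !hornerC.
Qed.

Lemma act_commr P x c : GRing.comm a c -> act P (x * c) = act P x * c.
Proof.
move=> ac; rewrite /act polyCM mulrA hornerM_comm ?hornerC //.
by rewrite /comm_poly hornerC.
Qed.

(** [f] is monic of least degree among the polynomials acting as zero. Its commutator with a
    constant acts as zero and loses the top term, so it vanishes; [E] has too small a degree to act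
    as zero. *)
Lemma exists_residue : algebraic_over_center a ->
  exists f E : {poly D}, [/\ forall d, f * d%:P = d%:P * f,
    f = E * ('X - a%:P) & exists x, act E x != 0].
Proof.
case=> p [p0 Fp /rootP pa0].
pose A (n : nat) : Prop := exists P, [/\ P != 0, size P = n & forall x, act P x = 0].
have exA : exists n, `[< A n >].
  exists (size p); apply/asboolP; exists p; split=> // x.
  have -> : act p x = (x%:P * p).[a].
    by congr _.[a]; apply/polyP => i; rewrite coefCM coefMC Fp.
  by rewrite mul_polyC hornerZ pa0 mulr0.
case: (ex_minnP exA) => n /asboolP[P [P0 sP actP]] minP.
have small Q : (size Q < n)%N -> (forall x, act Q x = 0) -> Q = 0.
  move=> sQ actQ; apply/eqP; apply: contraTT sQ => Q0; rewrite -leqNgt.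
  by apply/minP/asboolP; exists Q.
have l0 : lead_coef P != 0 by rewrite lead_coef_eq0.
pose f := (lead_coef P)^-1%:P * P.
have actf x : act f x = 0 by rewrite actM actP actC mulr0.
have sf : (size f <= n)%N.
  by rewrite -sP /f mul_polyC size_scale_leq.
have fn : f`_n.-1 = 1 by rewrite /f coefCM -sP -lead_coefE div_mulVr.
have n0 : (0 < n)%N by rewrite -sP size_poly_gt0.
clearbody f; have comm_f d : f * d%:P = d%:P * f.
  apply/eqP; rewrite -subr_eq0; apply/eqP/small => [|x]; last first.
    rewrite /act mulrBl hornerD hornerN -/(act (f * _) x) -/(act (_ * f) x).
    by rewrite actM actf actM actf actC mulr0 subrr.
  rewrite -(prednK n0) ltnS; apply/leq_sizeP => j; rewrite leq_eqVlt.
  rewrite coefB coefMC coefCM => /predU1P[<-|nj].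
    by rewrite fn mul1r mulr1 subrr.
  by rewrite nth_default ?mul0r ?mulr0 ?subrr // (leq_trans sf) // -(prednK n0).
have fa0 : root f a by apply/rootP; have := actf 1; rewrite /act polyC1 mulr1.
have /factor_theorem[E defE] := fa0.
exists f, E; split=> //.
have f0 : f != 0 by apply: contraNneq (oner_neq0 D) => f0; rewrite -fn f0 coef0.
have E0 : E != 0 by apply: contraNneq f0 => E0; rewrite defE E0 mul0r.
have sE : (size E < n)%N.
  apply: leq_trans sf; rewrite defE size_Mmonic ?monicXsubC // size_XsubC addn2.
  exact: ltnSn.
have [//|nE] := pselect (exists x, act E x != 0).
have E00 : E = 0.
  by apply: small => // x; apply/eqP/negP => nx; apply: nE; exists x; apply/negP.
by rewrite E00 eqxx in E0.
Qed.

Variables f E : {poly D}.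
Hypothesis f_comm : forall d, f * d%:P = d%:P * f.
Hypothesis f_fact : f = E * ('X - a%:P).
Hypothesis E_nz : exists x, act E x != 0.

Lemma Xsub_residue : ('X - a%:P) * E = f.
Proof.
apply: (monic_rreg (monicXsubC a)); rewrite -mulrA -f_fact.
by rewrite mulrBr mulrBl f_comm commr_polyX.
Qed.

Lemma residue_comm_poly c : GRing.comm a c -> E * c%:P = c%:P * E.
Proof.
move=> ac; apply: (monic_rreg (monicXsubC a)).
rewrite -[RHS]mulrA -f_fact -f_comm f_fact -!mulrA; congr (_ * _).
by rewrite mulrBr mulrBl commr_polyX -!polyCM ac.
Qed.

Lemma annihilator_act x : act f x = 0.
Proof.
rewrite /act f_comm f_fact mulrA; apply/rootP/factor_theorem.
by exists (x%:P * E).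
Qed.

Lemma annihilator_neq0 : f != 0.
Proof.
rewrite f_fact; apply: contraTneq isT => e.
have E0 : E = 0 by apply: (monic_rreg (monicXsubC a)); rewrite e mul0r.
by case: E_nz => x; rewrite E0 /act mul0r horner0 eqxx.
Qed.

(** ['X - a%:P] acts by x |-> x a - a x and kills the image of [E], since its product with [E] is
    [f]. *)
Lemma residue_central x : GRing.comm a (act E x).
Proof.
apply/esym/eqP; rewrite -subr_eq0 -actXsub -actM Xsub_residue.
by rewrite annihilator_act.
Qed.

Lemma residue_comml c x : GRing.comm a c -> act E (c * x) = c * act E x.
Proof. by move=> ac; rewrite -[RHS]actC -actM -residue_comm_poly // actM actC. Qed.

(** Integration by parts: with e = [act E], e(a z) = a e(z) = e(z) a = e(z a), so e kills
    commutators with [a]. *)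
Lemma residue_commutator g y :
  act E ((a * g - g * a) * y) = - act E (g * (a * y - y * a)).
Proof.
rewrite mulrBl mulrBr !actB opprB -!mulrA residue_comml // (mulrA g y) act_commr //.
by rewrite residue_central.
Qed.

Lemma act_resolvent z s c d :
  act E (d * (s - c)^-1 * z) =
  \sum_(p <- [seq (E`_i * d, z * a ^+ i) | i <- iota 0 (size E)])
     p.1 * (s - c)^-1 * p.2.
Proof.
rewrite big_map /act (@horner_coef_wide _ (size E)); last first.
  rewrite (leq_trans (size_polyMleq _ _)) // size_polyC.
  by case: (_ != 0); rewrite ?addn1 ?addn0 ?leq_pred.
rewrite -[iota 0 _](_ : index_iota 0 (size E) = _) ?big_mkord; last first.
  by rewrite /index_iota subn0.
by apply: eq_bigr => i _; rewrite coefMC !mulrA.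
Qed.

(** * Generic choice of the parameters *)

Hypothesis F_inf : infinite_set (ring_center D).

Lemma cofinitely_ex (A : D -> Prop) :
  cofinitely A -> exists t, ring_center D t /\ A t.
Proof.
move=> fA; apply: contrapT => nA; apply: F_inf; apply: sub_finite_set fA => t Ft.
by split=> // At; apply: nA; exists t.
Qed.

(** On the line [x + t * y] each of the finitely many conditions excludes finitely many central t,
    and the center is infinite. *)
Lemma avoid_kernels (I : eqType) (phi : I -> D -> D) (r : seq I) :
    (forall i t x y, ring_center D t -> phi i (x + t * y) = phi i x + t * phi i y) ->
    (forall i, i \in r -> exists y, phi i y != 0) ->
  exists x, forall i, i \in r -> phi i x != 0.
Proof.
move=> phi_lin; elim: r => [|i r IH] nz; first by exists 0.
have [|x xP] := IH; first by move=> j rj; apply: nz; rewrite inE rj orbT.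
have [y yP] := nz i (mem_head _ _).
have /cofinitely_ex[t [Ft tP]] :
    cofinitely (fun t => forall j, j \in i :: r -> phi j x + t * phi j y != 0).
  apply: cofinitely_seq => j; rewrite inE => /predU1P[->|/xP jx].
    by apply: cofinitely_affine; right.
  by apply: cofinitely_affine; left.
by exists (x + t * y) => j rj; rewrite phi_lin // tP.
Qed.

Lemma avoid_residue_kernels (r : seq D) :
  0 \notin r -> exists x, x != 0 /\ forall z, z \in r -> act E (x * z) != 0.
Proof.
move=> r0.
(* The extra entry 1 forces the chosen element to be nonzero. *)
have [i t x y Ft|z rz|x xP] :=
    @avoid_kernels D (fun z x => act E (x * z)) (1 :: r).
- by rewrite mulrDl -mulrA actD (act_center _ _ Ft).
- have z0 : z != 0.
    by case/predU1P: rz => [->|rz]; [apply: oner_neq0|apply: contraNneq r0 => <-].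
  by have [y yP] := E_nz; exists (y * z^-1); rewrite -mulrA div_mulVr // mulr1.
exists x; split=> [|z rz]; last by rewrite xP // inE rz orbT.
apply: contraTneq (xP _ (mem_head _ _)) => ->.
by rewrite mul0r /act mulr0 horner0 eqxx.
Qed.

(** On the line g = h0^-1 + s g1 the conditions on g are affine in s with nonzero slope. The inverse
    g1^-1 (s - c)^-1 is a resolvent with value h0 at s = 0, so its conditions hold there and hence
    generically. *)
Lemma avoid_residue_kernels_inv (r r' : seq D) :
    0 \notin r -> 0 \notin r' ->
  exists g, [/\ g != 0, forall z, z \in r -> act E (g * z) != 0
    & forall z, z \in r' -> act E (g^-1 * z) != 0].
Proof.
move=> /avoid_residue_kernels[g1 [g10 g1P]] /avoid_residue_kernels[h0 [h00 h0P]].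
pose c := - (h0^-1 * g1^-1).
have def_g s : h0^-1 + s * g1 = (s - c) * g1.
  by rewrite opprK mulrDl addrC -mulrA div_mulVr // mulr1.
have c0 : 0 != c.
  by rewrite eq_sym oppr_eq0 div_mul_neq0 // div_inv_neq0.
have def_gV s : s != c -> (h0^-1 + s * g1)^-1 = g1^-1 * (s - c)^-1.
  by move=> sc; rewrite def_g invrM // hD // subr_eq0.
have A1 : cofinitely (fun s => forall z, z \in r -> act E ((h0^-1 + s * g1) * z) != 0).
  apply: cofinitely_seq => z rz.
  have := cofinitely_affine (or_intror (act E (h0^-1 * z) != 0) (g1P _ rz)).
  apply: cofinitely_sub.
  by move=> t Ft; rewrite mulrDl -mulrA actD (act_center _ _ Ft).
have A2 : cofinitely (fun s => s != c /\
    forall z, z \in r' -> act E (g1^-1 * (s - c)^-1 * z) != 0).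
  apply: cofinitely_and; first exact: cofinitely_neq.
  apply: cofinitely_seq => z rz.
  have := @cofinitely_resolvent [seq (E`_i * g1^-1, z * a ^+ i) | i <- iota 0 (size E)]
     c 0 ring_center0 c0.
  rewrite -act_resolvent -def_gV // mul0r addr0 invrK h0P // => /(_ isT).
  by apply: cofinitely_sub => t Ft; rewrite -act_resolvent.
have /cofinitely_ex[s [Fs [s1 [sc s2]]]] := cofinitely_and A1 A2.
exists (h0^-1 + s * g1); split=> //; first by rewrite def_g div_mul_neq0 // subr_eq0.
by move=> z rz; rewrite def_gV // s2.
Qed.

Hypothesis a_ncentral : ~ ring_center D a.

(** If the conjugates b, b' for s, t both commute with [a], then (x + s) (b' - b) = (t - s) (a -
    b'). For s <> t, either b' = b = a or x + s is a quotient of elements commuting with [a]; both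
    make [x] commute with [a]. *)
Lemma cofinitely_conj_ncomm x : ~ GRing.comm a x ->
  cofinitely (fun s => ~ GRing.comm a ((x + s)^-1 * a * (x + s))).
Proof.
move=> nax; apply: cofinitely_subsingleton => s t Fs Ft /contrapT as_ /contrapT at_.
have ns u : ring_center D u -> ~ GRing.comm a (x + u).
  move=> Fu axu; apply: nax; rewrite -[x](addrK u).
  by apply: commrB => //; apply/commr_sym/Fu.
have n0 u : ring_center D u -> x + u != 0.
  by move=> Fu; apply: contra_not_neq (ns u Fu) => ->; apply: commr0.
set b := _ * a * _ in as_; set b' := _ * a * _ in at_.
have kb : (x + s) * b = a * (x + s) by rewrite /b !mulrA div_mulrV ?n0 // mul1r.
have kb' : (x + t) * b' = a * (x + t) by rewrite /b' !mulrA div_mulrV ?n0 // mul1r.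
apply: contrapT => st.
have Fts : ring_center D (t - s).
  by move=> y; apply/commr_sym/commrB; apply/commr_sym; [apply: Ft|apply: Fs].
have eq1 : (x + s) * (b' - b) = (t - s) * (a - b').
  have xs : x + s = (x + t) - (t - s) by rewrite opprD opprK addrA addrK.
  rewrite mulrBr kb mulrBr (Fts a) {1}xs mulrBl kb' addrAC -mulrBr.
  by rewrite opprD addrACA subrr add0r.
have [bb|bb] := eqVneq b' b.
  have : (t - s) * (a - b') == 0 by rewrite -eq1 bb subrr mulr0.
  rewrite div_mul_eq0 !subr_eq0 => /orP[/eqP ts|/eqP ab]; first by apply: st.
  by apply: (ns t Ft); rewrite /GRing.comm -kb' -ab.
apply: (ns s Fs); have -> : x + s = (t - s) * (a - b') * (b' - b)^-1.
  by rewrite -eq1 -mulrA div_mulrV ?mulr1 // subr_eq0.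
apply: commrM; first by apply: commrM; [apply/commr_sym/Fts|apply: commrB].
by apply: commrV; apply: commrB.
Qed.

(** By [residue_commutator] each pairing is, up to sign, e applied to g or g^-1 times a y - y a. It
    suffices that finitely many elements y do not commute with [a]; then [avoid_residue_kernels_inv]
    yields [g]. *)
Lemma exists_parameters : a != 0 ->
  exists (k : bool -> D) (g m : D),
  [/\ forall b, k b != 0, g != 0 /\ m != 0,
    act E ((a * g - g * a) * m) != 0 /\ act E ((a * g - g * a) * m^-1) != 0,
    forall b b' y, y \in [:: a; a^-1] ->
      act E ((a * g^-1 - g^-1 * a) * ((k b)^-1 * y * k b')) != 0
    & forall b, act E ((a * g^-1 - g^-1 * a) * ((k b)^-1 * k (~~ b))) != 0].
Proof.
move=> a0; have [x0 nax0] : exists x, ~ GRing.comm a x.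
  by apply: contrapT => n; apply: a_ncentral => x; apply: contrapT => nx;
    apply: n; exists x.
have n0 x : ~ GRing.comm a x -> x != 0.
  by apply: contra_not_neq => ->; apply: commr0.
have nV x : ~ GRing.comm a x -> ~ GRing.comm a x^-1.
  by move=> nx /commrV; rewrite invrK.
have br0 x : ~ GRing.comm a x <-> a * x - x * a != 0.
  by rewrite subr_eq0; split=> [n|/eqP//]; apply/eqP.
(* [c] will serve both as [k true] and as [m]. *)
have [s [_ n_conj_c]] := cofinitely_ex (cofinitely_conj_ncomm nax0).
set c := x0 + s in n_conj_c.
have nc : ~ GRing.comm a c.
  move=> ac; apply: n_conj_c; apply: commrM => //; apply: commrM => //.
  exact: commrV.
have c0 := n0 _ nc; have cV0 := div_inv_neq0 c0; have aV0 := div_inv_neq0 a0.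
pose phi z x := a * (z * x) - z * x * a.
have phi_lin z t x y : ring_center D t -> phi z (x + t * y) = phi z x + t * phi z y.
  move=> Ft; have sw u v : u * (t * v) = t * (u * v) by rewrite !mulrA (Ft u).
  by rewrite /phi !mulrDr mulrDl !sw -(mulrA t) opprD addrACA mulrN.
pose r := [:: 1; c^-1; c^-1 * a; c^-1 * a^-1].
have [|x1 x1P] := avoid_kernels (r := r) phi_lin.
  move=> z rz; have z0 : z != 0.
    by move: rz; rewrite !inE => /or4P[] /eqP->; rewrite ?oner_eq0 ?div_mul_neq0.
  by exists (z^-1 * x0); apply/br0; rewrite mulrA div_mulrV // mul1r.
have nx1 : ~ GRing.comm a x1.
  by apply/br0; have := x1P 1 (mem_head _ _); rewrite /phi mul1r.
have /cofinitely_ex[t [Ft [rl n_conj_l]]] : cofinitely (fun t =>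
    (forall z, z \in r -> phi z (x1 + t) != 0) /\
    ~ GRing.comm a ((x1 + t)^-1 * a * (x1 + t))).
  apply: cofinitely_and (cofinitely_conj_ncomm nx1).
  apply: cofinitely_seq => z /x1P z1.
  apply: cofinitely_sub (cofinitely_affine (or_introl (phi z 1 != 0) z1)) => t Ft.
  by rewrite -phi_lin // mulr1.
set l := x1 + t in rl n_conj_l.
have nl : ~ GRing.comm a l.
  by apply/br0; have := rl 1 (mem_head _ _); rewrite /phi mul1r.
have l0 := n0 _ nl; have lV0 := div_inv_neq0 l0.
have n1 : ~ GRing.comm a (c^-1 * l) by apply/br0/rl; rewrite !inE eqxx ?orbT.
have n2 : ~ GRing.comm a (c^-1 * a * l) by apply/br0/rl; rewrite !inE eqxx ?orbT.
have n3 : ~ GRing.comm a (c^-1 * a^-1 * l) by apply/br0/rl; rewrite !inE eqxx ?orbT.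
(* Noncommutation passes to inverses, and inversion swaps [b] and [b'], so only half of the mixed
   conditions had to be arranged. *)
have inv3 x y z : x != 0 -> y != 0 -> z != 0 -> (x^-1 * y * z)^-1 = z^-1 * y^-1 * x.
  move=> x00 y00 z00; have xV0 := div_inv_neq0 x00.
  by rewrite !invrM ?hD ?div_mul_neq0 // invrK mulrA.
pose k b := if b then c else l.
have k0 b : k b != 0 by case: b.
have nk b b' y : y \in [:: a; a^-1] -> ~ GRing.comm a ((k b)^-1 * y * k b').
  rewrite !inE => /orP[] /eqP->; case: b b' => [] [] //=.
  - by have := nV _ n3; rewrite inv3 // invrK.
  - by have := nV _ n_conj_c; rewrite inv3.
  - by have := nV _ n2; rewrite inv3.
  - by have := nV _ n_conj_l; rewrite inv3.
have nkV b : ~ GRing.comm a ((k b)^-1 * k (~~ b)).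
  case: b => //=; have := nV _ n1.
  by rewrite invrM ?hD // invrK.
pose comm x := a * x - x * a.
pose r1 := [seq comm y | y <- [:: c; c^-1]].
pose r2 := [seq comm y | y <- [seq (k p.1)^-1 * y * k p.2 |
   p <- enum {: bool * bool}, y <- [:: a; a^-1]] ++
   [seq (k b)^-1 * k (~~ b) | b <- enum {: bool}]].
have r10 : 0 \notin r1.
  apply/negP => /mapP[y]; rewrite !inE => ry /esym/eqP; apply/negP/br0.
  by case/orP: ry => /eqP-> //; apply: nV.
have r20 : 0 \notin r2.
  apply/negP => /mapP[y]; rewrite mem_cat => ry /esym/eqP; apply/negP/br0.
  case/orP: ry => [/allpairsP[[p z] /= [_ za ->]]|/mapP[b _ ->]]; last exact: nkV.
  exact: nk.
have [g [g0 gP gVP]] := avoid_residue_kernels_inv r10 r20.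
exists k, g, c; split=> [//|//||b b' y ya|b].
- rewrite !residue_commutator !oppr_eq0; split; apply: gP; apply: (map_f comm).
    by rewrite !inE eqxx.
  by rewrite !inE eqxx orbT.
- rewrite residue_commutator oppr_eq0; apply: gVP; apply: (map_f comm).
  rewrite mem_cat; apply/orP; left.
  by apply/allpairsP; exists ((b, b'), y); rewrite mem_enum.
- rewrite residue_commutator oppr_eq0; apply: gVP; apply: (map_f comm).
  rewrite mem_cat; apply/orP; right.
  by apply/mapP; exists b; rewrite ?mem_enum.
Qed.

(** * Families with poles of rank one *)

(** In a division ring the default value 1 is reached only at 0. *)
Definition to_unit x : unit_group D := insubd (1%g : unit_group D) x.

Lemma val_to_unit x : x != 0 -> val (to_unit x) = x.
Proof. by move=> x0; rewrite val_insubd hD. Qed.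

(** The side of the denominator is immaterial, as [f.[t]] is central by [annihilator_center]. *)
Definition represents (X : D -> unit_group D) N P :=
  forall t, ring_center D t -> f.[t] != 0 -> val (X t) * f.[t] ^+ N = P.[t].

(* The function [X] is P / f ^ N with a leading coefficient of rank one.  The
   factor [c] accounts for [v] being determined only up to the centralizer. *)
Definition polar (X : D -> unit_group D) (v u : D) :=
  exists N P c, [/\ (0 < N)%N, represents X N P, GRing.comm a c, c != 0
    & forall x, act P x = v * c * act E (u * x)].

Lemma annihilator_center t d : ring_center D t -> GRing.comm f.[t] d.
Proof.
move=> Ft; have := congr1 (fun P => P.[t]) (f_comm d).
by rewrite !hornerM_center // hornerC.
Qed.

Lemma represents_mul X Y N M P Q : represents X N P -> represents Y M Q ->
  represents (fun t => X t * Y t)%g (N + M) (P * Q).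
Proof.
move=> XP YQ t Ft ft; rewrite hornerM_center // -XP // -YQ // exprD !mulrA.
congr (_ * _); rewrite -!mulrA; congr (_ * _).
by apply/esym/commr_sym/commrX/commr_sym/annihilator_center.
Qed.

Lemma represents_const (b : unit_group D) : represents (fun=> b) 0 (val b)%:P.
Proof. by move=> t _ _; rewrite hornerC expr0 mulr1. Qed.

Lemma polar_lmul (b : unit_group D) X v u :
  polar X v u -> polar (fun t => b * X t)%g (val b * v) u.
Proof.
case=> N [P [c [N0 XP ac c0 Pact]]]; exists N, ((val b)%:P * P), c; split=> //.
  exact: (represents_mul (represents_const b) XP).
by move=> x; rewrite actM actC Pact !mulrA.
Qed.

Lemma polar_rmul (b : unit_group D) X v u :
  polar X v u -> polar (fun t => X t * b)%g v (u * val b).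
Proof.
case=> N [P [c [N0 XP ac c0 Pact]]]; exists N, (P * (val b)%:P), c; split=> //.
  by have := represents_mul XP (represents_const b); rewrite addn0.
by move=> x; rewrite actM actC Pact !mulrA.
Qed.

(** [act] turns products into composites, and v c e(u v' d e(u' x)) = v (c e(u v') d) e(u' x)
    because e is right linear over the centralizer of [a]. *)
Lemma polar_mul X Y v u v' u' : polar X v u -> polar Y v' u' ->
  act E (u * v') != 0 -> polar (fun t => X t * Y t)%g v u'.
Proof.
move=> [N [P [c [N0 XP ac c0 Pact]]]] [M [Q [d [M0 YQ ad d0 Qact]]]] uv0.
exists (N + M)%N, (P * Q), (c * act E (u * v') * d); split.
- by rewrite addn_gt0 N0.
- exact: represents_mul.
- by apply: commrM => //; apply: commrM => //; apply: residue_central.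
- by rewrite !div_mul_neq0.
move=> x; rewrite actM Pact Qact !mulrA -(mulrA _ d) act_commr ?mulrA //.
by apply: commrM => //; apply: residue_central.
Qed.

Lemma polar_expg X v u n : polar X v u -> act E (u * v) != 0 ->
  polar (fun t => X t ^+ n.+1)%g v u.
Proof.
move=> Xvu uv; elim: n => [//|n IH].
by under eq_fun do rewrite expgS; apply: polar_mul Xvu IH uv.
Qed.

Lemma polar_commutator (b : unit_group D) X v u v' u' :
    polar X v u -> polar (fun t => (X t)^-1)%g v' u' ->
    act E (u * (val b)^-1 * v') != 0 -> act E (u * val b * v') != 0 ->
  polar (fun t => b * X t * b^-1 * (X t)^-1)%g (val b * v) u' /\
  polar (fun t => (b * X t * b^-1 * (X t)^-1)^-1)%g v (u' * (val b)^-1).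
Proof.
move=> Xvu XVvu uv uv'; split.
  exact: polar_mul (polar_rmul b^-1%g (polar_lmul b Xvu)) XVvu uv.
have -> : (fun t => (b * X t * b^-1 * (X t)^-1)^-1)%g =
    (fun t => X t * b * (X t)^-1 * b^-1)%g.
  by apply/funext => t; rewrite !invgM !invgK !mulgA.
apply: (@polar_rmul b^-1%g); exact: polar_mul (polar_rmul b Xvu) XVvu uv'.
Qed.

(** As N > 0, [f ^+ N] acts as zero, so [P - f ^+ N] acts like [P], nontrivially at u^-1 y when e(y)
    <> 0. It is thus a nonzero polynomial, while X t = 1 would make t a root of it. *)
Lemma polar_cofinitely X v u : v != 0 -> u != 0 -> polar X v u ->
  cofinitely (fun t => f.[t] != 0 /\ X t <> 1%g).
Proof.
move=> v0 u0 [N [P [c [N0 XP ac c0 Pact]]]].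
have PN : P - f ^+ N != 0.
  apply/eqP => /(congr1 act); case: E_nz => y Ey /(congr1 (@^~ (u^-1 * y))).
  rewrite {1}/act mulrBl hornerD hornerN -!/(act _ _) -(prednK N0) exprS actM.
  rewrite annihilator_act subr0 Pact mulrA div_mulrV // mul1r.
  rewrite /act mul0r horner0 => /eqP; apply/negP.
  by rewrite !div_mul_neq0.
apply: cofinitely_sub (cofinitely_and (cofinitely_horner annihilator_neq0)
  (cofinitely_horner PN)) => t Ft [ft].
rewrite hornerD hornerN -XP // => PN0; split=> // X1; move: PN0; rewrite X1 mul1r.
have -> : (f ^+ N).[t] = f.[t] ^+ N.
  by elim: (N) => [|n IH]; rewrite ?expr0 ?hornerC // !exprS hornerM_center // IH.
by rewrite subrr eqxx.
Qed.

Definition conj_Xsub (g : unit_group D) (t : D) : unit_group D :=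
  ((to_unit (t - a))^-1 * g * to_unit (t - a))%g.

(** The numerator acts by x |-> e(g (x a - a x)), which is e((a g - g a) x) after integration by
    parts. *)
Lemma polar_conj_Xsub g : polar (conj_Xsub g) 1 (a * val g - val g * a).
Proof.
exists 1%N, (E * (val g)%:P * ('X - a%:P)), 1; split=> //.
- move=> t Ft ft; rewrite expr1 /conj_Xsub.
  have ta : t - a != 0.
    by apply: contra_notN a_ncentral; rewrite subr_eq0 => /eqP <-.
  rewrite [val _](_ : _ = (t - a)^-1 * val g * (t - a)); last first.
    by rewrite -[in RHS](val_to_unit ta).
  rewrite -mulrA -(annihilator_center _ Ft) mulrA -(annihilator_center _ Ft).
  rewrite !hornerM_center // hornerC hornerXsubC {1}f_fact hornerM_center //.
  by rewrite hornerXsubC !mulrA -(mulrA _ _ (_^-1)) div_mulrV // mulr1.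
- exact: commr1.
- exact: oner_neq0.
move=> x; rewrite !actM actXsub actC mulrBr actB !mulr1 mul1r mulrBl actB.
by rewrite (mulrA (val g) x) act_commr // -residue_central -residue_comml // !mulrA.
Qed.

(** Since [m] is conjugated, the inverse is the same expression in m^-1 and shares the same v and
    u. *)
Definition base (k g m : unit_group D) (t : D) : unit_group D :=
  (k * (conj_Xsub g t * m * conj_Xsub g^-1 t) * k^-1)%g.

Lemma base_inv k g m t : ((base k g m t)^-1 = base k g m^-1 t)%g.
Proof. by rewrite /base /conj_Xsub !invgM !invgK !mulgA. Qed.

Lemma polar_base k g m :
    act E ((a * val g - val g * a) * val m) != 0 ->
  polar (base k g m) (val k) ((a * (val g)^-1 - (val g)^-1 * a) * (val k)^-1).
Proof.
move=> gm; rewrite -[val k in X in polar _ X]mulr1.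
apply: (@polar_rmul k^-1%g); apply: polar_lmul.
apply: polar_mul (polar_rmul m (polar_conj_Xsub g)) (polar_conj_Xsub g^-1%g) _.
by rewrite mulr1.
Qed.

(** * Descent along the almost subnormal chain *)

Variables (al : unit_group D) (k : bool -> unit_group D) (w : D).
Hypothesis al_val : val al = a.
Hypothesis w_pm : forall b b' y, y \in [:: a; a^-1] ->
  act E (w * ((val (k b))^-1 * y * val (k b'))) != 0.
Hypothesis w_0 : forall b, act E (w * ((val (k b))^-1 * val (k (~~ b)))) != 0.

(* The invariant kept along the chain of subgroups: [j] counts the commutators
   with [a] taken so far. *)
Definition tower (x : bool -> D -> unit_group D) (j : nat) := forall b,
  polar (x b) (a ^+ j.+1 * val (k b)) (w * (val (k b))^-1 * a^-1 ^+ j) /\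
  polar (fun t => (x b t)^-1)%g
    (a ^+ j * val (k b)) (w * (val (k b))^-1 * a^-1 ^+ j.+1).

Lemma tower_a_neq0 : a != 0.
Proof. by apply: contra_notN a_ncentral => /eqP ->; apply: ring_center0. Qed.

Lemma expV_cancel j y : GRing.comm a y -> a^-1 ^+ j * y * a ^+ j = y.
Proof.
move=> ay; rewrite exprVn -mulrA (commrX _ (commr_sym ay)) mulrA.
by rewrite div_mulVr ?mul1r // div_expr_neq0 // tower_a_neq0.
Qed.

(** The powers of [a] cancel, so finitely many conditions at level 0 serve all levels j. *)
Lemma tower_pairing j y b b' : GRing.comm a y ->
  (w * (val (k b))^-1 * a^-1 ^+ j) * y * (a ^+ j * val (k b')) =
  w * ((val (k b))^-1 * y * val (k b')).
Proof.
move=> ay; rewrite -!mulrA; congr (_ * (_ * _)).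
by rewrite !mulrA expV_cancel.
Qed.

Lemma tower_pairing_pm j y b b' : y \in [:: a; a^-1] ->
  act E ((w * (val (k b))^-1 * a^-1 ^+ j) * y * (a ^+ j * val (k b'))) != 0.
Proof.
move=> ya; rewrite tower_pairing ?w_pm //.
by move: ya; rewrite !inE => /orP[] /eqP-> //; apply: commrV.
Qed.

(** Here [c] and [c'] count as 0 or 1. Equal signs leave one factor a or a^-1 in the middle
    ([w_pm]); opposite signs leave none, and then reducedness gives b' = [~~ b] ([w_0]). *)
Lemma tower_pairing_letter j (c c' : bool) b b' :
    ~~ ((b == b') && (c != c')) ->
  act E ((w * (val (k b))^-1 * a^-1 ^+ (j + c)) *
         (a ^+ (j + ~~ c') * val (k b'))) != 0.
Proof.
case: c c' => [] [] /=; rewrite ?addn1 ?addn0 ?eqxx ?andbF ?andbT => bb.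
- rewrite exprSr !mulrA -(mulrA _ _ (val _)) tower_pairing_pm //.
  by rewrite !inE eqxx orbT.
- rewrite -[X in X * (_ * _)]mulr1 tower_pairing; last exact: commr1.
  by rewrite mulr1; case: b b' bb => [] [] // _; apply: (w_0 _).
- rewrite -[X in X * (_ * _)]mulr1 tower_pairing; last exact: commr1.
  by rewrite mulr1; case: b b' bb => [] [] // _; apply: (w_0 _).
- rewrite exprS !mulrA -(mulrA _ _ (val _)) tower_pairing_pm //.
  by rewrite !inE eqxx.
Qed.

Lemma tower_commutator (x : bool -> D -> unit_group D) j : tower x j ->
  tower (fun b t => al * x b t * al^-1 * (x b t)^-1)%g j.+1.
Proof.
move=> xj b; have [xb xVb] := xj b.
have [] := polar_commutator (b := al) xb xVb.
- by rewrite al_val tower_pairing_pm // !inE eqxx orbT.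
- by rewrite al_val tower_pairing_pm // !inE eqxx.
by rewrite al_val mulrA -exprS -[_ * _ * a^-1]mulrA -exprSr.
Qed.

Lemma tower_expg (x : bool -> D -> unit_group D) j n :
  tower x j -> tower (fun b t => x b t ^+ n.+1)%g j.
Proof.
move=> xj b; have [xb xVb] := xj b; split.
  apply: polar_expg => //.
  by have := @tower_pairing_letter j false false b b; rewrite eqxx addn0 addn1; apply.
under eq_fun do rewrite -expVgn; apply: polar_expg => //.
by have := @tower_pairing_letter j true true b b; rewrite eqxx addn0 addn1; apply.
Qed.

Lemma tower_letter (x : bool -> D -> unit_group D) j l : tower x j ->
  polar (fun t => letter_val (x l.1 t, l.2))
    (a ^+ (j + ~~ l.2) * val (k l.1)) (w * (val (k l.1))^-1 * a^-1 ^+ (j + l.2)).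
Proof.
by case: l => b [] /(_ b) [xb xVb]; rewrite ?addn0 ?addn1.
Qed.

Lemma tower_word (x : bool -> D -> unit_group D) j l u :
  tower x j -> reduced_bool (l :: u) ->
  polar (fun t => \prod_(m <- l :: u) letter_val (x m.1 t, m.2))%g
    (a ^+ (j + ~~ l.2) * val (k l.1))
    (w * (val (k (last l u).1))^-1 * a^-1 ^+ (j + (last l u).2)).
Proof.
move=> xj; elim: u l => [|m u IH] l.
  by move=> _; under eq_fun do rewrite big_cons big_nil mulg1; apply: tower_letter.
move=> /= /andP[lm red]; under eq_fun do rewrite big_cons.
by apply: polar_mul (tower_letter l xj) (IH m red) _; apply: tower_pairing_letter.
Qed.

Lemma tower_free (x : bool -> D -> unit_group D) j u :
  tower x j -> reduced_bool u -> u <> [::] ->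
  cofinitely (fun t => \prod_(m <- u) letter_val (x m.1 t, m.2) <> 1)%g.
Proof.
case: u => [//|l u] xj red _; have a0 := tower_a_neq0.
have vn0 (v : unit_group D) : val v != 0.
  by apply: contraTneq (valP v) => ->; rewrite unitr0.
have w0 : w != 0.
  by apply: contraNneq (w_0 true) => ->; rewrite mul0r /act mulr0 horner0.
apply: cofinitely_sub (polar_cofinitely _ _ (tower_word xj red)).
- by move=> t Ft [].
- by rewrite div_mul_neq0 // div_expr_neq0.
- by rewrite !div_mul_neq0 ?div_inv_neq0 // div_expr_neq0 // div_inv_neq0.
Qed.

(** [al] lies in every [C i], so at a normal step commutators with [al] fall into the next subgroup;
    at a step of finite index a uniform power does. *)
Lemma tower_descent (n : nat) (C : nat -> set (unit_group D))
    (x : bool -> D -> unit_group D) :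
    C 0%N = [set: unit_group D] -> C n al ->
    (forall i, (i <= n)%N -> subgroup (C i)) ->
    (forall i, (i < n)%N -> C i.+1 `<=` C i) ->
    (forall i, (i < n)%N ->
       normal_in (C i.+1) (C i) \/ finite_index_in (C i.+1) (C i)) ->
    tower x 0 ->
  exists (y : bool -> D -> unit_group D) j, tower y j /\ forall b t, C n (y b t).
Proof.
move=> C0 Cal Cg Csub Cstep x0.
have Cal' i : (i <= n)%N -> C i al.
  move=> lein; rewrite -(subKn lein); elim: (n - i)%N (leq_subr i n) => [|d IH] dn.
    by rewrite subn0.
  apply: Csub; first by rewrite ltn_subrL (leq_trans _ dn).
  by rewrite subnSK //; apply/IH/ltnW.
have: (n <= n)%N by [].
elim: {-2}n => [|i IH] le_in; first by exists x, 0%N; rewrite C0.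
have [y [j [yj Cy]]] := IH (ltnW le_in).
have [_ CM CV] := Cg _ le_in.
have [[_ nor]|fin] := Cstep _ le_in.
  exists (fun b t => al * y b t * al^-1 * (y b t)^-1)%g, j.+1.
  split=> [|b t]; first exact: tower_commutator.
  have := nor (y b t)^-1%g al^-1%g; rewrite /conjg invgK !mulgA.
  have [_ _ CiV] := Cg _ (ltnW le_in).
  move=> H; rewrite -!mulgA; apply: CM; first exact: Cal'.
  by rewrite !mulgA; apply: H; [apply: CiV|apply: CV; apply: Cal'].
have [m powm] := finite_index_expg (Cg _ le_in) (Cg _ (ltnW le_in)) fin.
exists (fun b t => y b t ^+ m.+1)%g, j.
by split=> [|b t]; [apply: tower_expg|apply: powm].
Qed.

End Residue.
End DivisionRing.

Theorem theorem5p3 (D : unitRingType) (hD : division_ring D)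
    (hF : ~ countable (ring_center D)) (G : set (unit_group D))
    (hGsub : almost_subnormal G [set: unit_group D])
    (hGnc : ~ ([set val u | u in G] `<=` ring_center D))
    (hGalg : exists u : unit_group D,
       [/\ G u, ~ ring_center D (val u) & algebraic_over_center (val u)]) :
  exists H : set (unit_group D),
    [/\ subgroup H, H `<=` G, free_subgroup H & ~ cyclic_subgroup H].
Proof.
case: hGsub hGalg => n [C [C0 CG Cg Csub Cstep]] [al [Gal al_nc al_alg]].
have F_inf : infinite_set (ring_center D).
  by move=> /finite_set_countable.
have [f [E [f_comm f_fact E_nz]]] := exists_residue hD al_alg.
have al0 : val al != 0 by apply: contra_notN al_nc => /eqP ->; apply: ring_center0.
have [k [g [m [k0 [g0 m0] [gm gmV] w_pm w_0]]]] :=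
  exists_parameters hD f_comm f_fact E_nz F_inf al_nc al0.
pose k' b := to_unit (k b).
have vk b : val (k' b) = k b by apply: val_to_unit.
set w := val al * g^-1 - g^-1 * val al in w_pm w_0.
pose x1 b := base (val al) (k' b) (to_unit g) (to_unit m).
have vg := val_to_unit hD g0; have vm := val_to_unit hD m0.
have valV (u : unit_group D) : val u^-1%g = (val u)^-1 by [].
have polar_x1 b (gu mu : unit_group D) : val gu = g ->
    act (val al) E ((val al * g - g * val al) * val mu) != 0 ->
    polar (val al) f E (base (val al) (k' b) gu mu) (k b) (w * (k b)^-1).
  by move=> vgu; rewrite /w -vgu -vk; apply: polar_base.
(* [x1 b] pairs with itself to e(w), which is 0 since [w] is a commutator with [al]. One initial
   commutator with [al] inserts the power of [al] that makes these pairings nonzero. *)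
have x0 : tower (val al) f E k' w
    (fun b t => al * x1 b t * al^-1 * (x1 b t)^-1)%g 0.
  move=> b.
  have p1 : polar (val al) f E (x1 b) (k b) (w * (k b)^-1).
    by apply: polar_x1; rewrite ?vm.
  have p2 : polar (val al) f E (fun t => (x1 b t)^-1)%g (k b) (w * (k b)^-1).
    have -> : (fun t => (x1 b t)^-1)%g =
        base (val al) (k' b) (to_unit g) (to_unit m)^-1%g.
      by apply/funext => t; apply: base_inv.
    by apply: polar_x1; rewrite ?valV ?vm.
  have wk y : y \in [:: val al; (val al)^-1] ->
      act (val al) E (w * (k b)^-1 * y * k b) != 0.
    by move=> ya; rewrite -!mulrA (mulrA (k b)^-1); apply: w_pm.
  rewrite vk !expr1 !expr0 mulr1 mul1r; apply: polar_commutator p1 p2 _ _ => //.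
    by apply: wk; rewrite !inE eqxx orbT.
  by apply: wk; rewrite !inE eqxx.
have w_pm' b b' y : y \in [:: val al; (val al)^-1] ->
    act (val al) E (w * ((val (k' b))^-1 * y * val (k' b'))) != 0.
  by rewrite !vk; apply: w_pm.
have w_0' b : act (val al) E (w * ((val (k' b))^-1 * val (k' (~~ b)))) != 0.
  by rewrite !vk; apply: w_0.
have Cal : C n al by rewrite CG.
have [x [j [xj Cx]]] := tower_descent hD f_comm f_fact al_nc erefl w_pm' w_0'
  C0 Cal Cg Csub Cstep x0.
pose val_w t (u : seq (bool * bool)) :=
  (\prod_(m <- u) letter_val (x m.1 t, m.2))%g.
have [t [Ft tP]] : exists t, ring_center D t /\
    forall u, reduced_bool u -> u <> [::] -> val_w t u <> 1%g.
  (* If every central t failed for some word, the center would be covered by countably many finite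
     sets [B u]. *)
  apply: contrapT => nt; apply: hF.
  pose W := [set u : seq (bool * bool) | reduced_bool u /\ u <> [::]].
  pose B u := [set t | ring_center D t /\ ~ (val_w t u <> 1%g)].
  have : countable (\bigcup_(u in W) B u).
    apply: bigcup_countable => [|u [ur u0]]; first exact: countableP.
    apply: finite_set_countable.
    exact: (tower_free hD f_comm f_fact E_nz al_nc w_pm' w_0' xj ur u0).
  apply: sub_countable; apply: subset_card_le => t Ft.
  apply: contrapT => nB; apply: nt; exists t; split=> // u ur u0.
  by apply: contrapT => nu; apply: nB; exists u.
have [free ncyc] := @free_pair _ (x^~ t) tP.
exists (generated (range (fun b => x b t))); split=> //.
  exact: subgroup_generated.
apply: smallest_sub; first by rewrite -CG; apply: Cg.
by move=> _ [b _ <-]; rewrite -CG.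
Qed.
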